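(* The frozen coefficients problem $$\frac{1}{\hat\rho\hat c^2}\,\partial_tp+{\rm div}\,v=0,\qquad \hat\rho\,\partial_tv+\nabla p-\hat\rho\sum_{j=1}^3\mathcal{L}_jF_j=0,\qquad \partial_tF_j-\mathcal{L}_jv=0\ (j=1,2,3)\quad\text{in }\mathbb{R}_+\times\mathbb{R}^3_+,$$ $$\partial_t\varphi=v_1+\hat a_0\varphi,\qquad p=\hat a\varphi\quad\text{on }\mathbb{R}_+\times\{x_1=0\}\times\mathbb{R}^2,$$ with $\hat a=-\partial_1\hat p$, is ill-posed if and only if the three constant vectors $\widehat F_j=(0,\widehat F_{2j},\widehat F_{3j})$, $j=1,2,3$, are collinear, i.e. $$\widehat F_{21}\widehat F_{32}-\widehat F_{31}\widehat F_{22}=\widehat F_{21}\widehat F_{33}-\widehat F_{31}\widehat F_{23}=\widehat F_{22}\widehat F_{33}-\widehat F_{32}\widehat F_{23}=0,$$ and the constant (frozen) coefficient $\partial_1\hat p$ is negative: $\partial_1\hat p<0$.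
   Context: Here $\mathbb{R}^3_+=\{x_1>0,\ x'=(x_2,x_3)\in\mathbb{R}^2\}$, and the unknowns are $p$ (scalar), $v=(v_1,v_2,v_3)$, $F_j=(F_{1j},F_{2j},F_{3j})$ ($j=1,2,3$), functions of $(t,x)$, and $\varphi=\varphi(t,x')$, with some initial data. The quantities $\hat\rho>0$, $\hat c>0$, $\widehat F_{2j},\widehat F_{3j}\in\mathbb{R}$, $\hat a_0\in\mathbb{R}$ and $\partial_1\hat p\in\mathbb{R}$ are given constants ($\hat a_0$ and $\partial_1\hat p$ are frozen values of $\partial_1\hat v_1$ and of the normal derivative of the unperturbed pressure, and are treated simply as constants). The operators are $\mathcal{L}_j=\widehat F_{2j}\partial_2+\widehat F_{3j}\partial_3$. Ill-posedness is understood in the Hadamard sense of exponential sequences: the problem is ill-posed if there are $\omega'=(\omega_2,\omega_3)\in\mathbb{R}^2$ and, for all sufficiently large $n\in\mathbb{N}$, non-trivial (complex-valued) solutions of the form $$(p,v,F_1,F_2,F_3)=\bar U_n\exp\{n(s_nt+\lambda_nx_1+i(\omega',x'))\},\qquad \varphi=\bar\varphi_n\exp\{n(s_nt+i(\omega',x'))\},$$ with constant $\bar U_n\in\mathbb{C}^{13}$, $\bar\varphi_n\in\mathbb{C}$, $s_n,\lambda_n\in\mathbb{C}$, $\Re s_n>0$, $\Re\lambda_n<0$, such that $n\,\Re s_n\to\infty$ as $n\to\infty$ (so that the solutions have infinite growth as $n\to\infty$ for any fixed $t>0$). Mere exponential instability (with $n\,\Re s_n$ bounded) does not count as ill-posedness.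 *)

(* Defs.v *)
From Stdlib Require Import Reals Lra.
From Coquelicot Require Import Coquelicot.

Open Scope R_scope.

Inductive idx : Set := i1 | i2 | i3.

Definition sum3 (f : idx -> C) : C := (f i1 + f i2 + f i3)%C.

(** Complex-valued functions of [(t, x1, x2, x3)] and of [(t, x2, x3)]. *)
Definition field := R -> R -> R -> R -> C.
Definition bfield := R -> R -> R -> C.

(** Coquelicot's [Derive] and [ex_derive] are applied to real and imaginary
    parts: its [C_derive] is the holomorphic derivative of a map [C -> C]. *)
Definition CDerive (f : R -> C) (y : R) : C :=
  (Derive (fun z => Re (f z)) y, Derive (fun z => Im (f z)) y).

Definition ex_Cderive (f : R -> C) (y : R) : Prop :=
  ex_derive (fun z => Re (f z)) y /\ ex_derive (fun z => Im (f z)) y.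

Definition dt (f : field) : field :=
  fun t x1 x2 x3 => CDerive (fun z => f z x1 x2 x3) t.

Definition dx (k : idx) (f : field) : field :=
  fun t x1 x2 x3 =>
    match k with
    | i1 => CDerive (fun z => f t z x2 x3) x1
    | i2 => CDerive (fun z => f t x1 z x3) x2
    | i3 => CDerive (fun z => f t x1 x2 z) x3
    end.

Definition has_partials (f : field) (t x1 x2 x3 : R) : Prop :=
  ex_Cderive (fun z => f z x1 x2 x3) t /\
  ex_Cderive (fun z => f t z x2 x3) x1 /\
  ex_Cderive (fun z => f t x1 z x3) x2 /\
  ex_Cderive (fun z => f t x1 x2 z) x3.

(** The 13 interior unknowns; [F U j i] is the [i]-th component of the vector
    [F_j], written [F_{ij}] in subscript notation. *)
Record unknowns (A : Type) : Type := Unknowns {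
  p : A;
  v : idx -> A;
  F : idx -> idx -> A
}.
Arguments Unknowns {A}.
Arguments p {A}.
Arguments v {A}.
Arguments F {A}.

Definition all_components {A : Type} (P : A -> Prop) (U : unknowns A) : Prop :=
  P (p U) /\ (forall i, P (v U i)) /\ (forall j i, P (F U j i)).

(** [F2 j] and [F3 j] are the second and third components of the constant
    vector [(0, F2 j, F3 j)]. *)
Definition Lop (F2 F3 : idx -> R) (j : idx) (f : field) : field :=
  fun t x1 x2 x3 =>
    (F2 j * dx i2 f t x1 x2 x3 + F3 j * dx i3 f t x1 x2 x3)%C.

Definition interior_equations (rho c : R) (F2 F3 : idx -> R)
    (U : unknowns field) (t x1 x2 x3 : R) : Prop :=
  ((1 / (rho * c ^ 2))%R * dt (p U) t x1 x2 x3
     + sum3 (fun k => dx k (v U k) t x1 x2 x3) = 0)%C /\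
  (forall i,
     (rho * dt (v U i) t x1 x2 x3 + dx i (p U) t x1 x2 x3
        - rho * sum3 (fun j => Lop F2 F3 j (F U j i) t x1 x2 x3) = 0)%C) /\
  (forall j i,
     (dt (F U j i) t x1 x2 x3 - Lop F2 F3 j (v U i) t x1 x2 x3 = 0)%C).

(** [dp] is the frozen normal derivative of the unperturbed pressure. *)
Definition boundary_conditions (a0 dp : R)
    (U : unknowns field) (phi : bfield) (t x2 x3 : R) : Prop :=
  let a := (- dp)%R in
  CDerive (fun z => phi z x2 x3) t = (v U i1 t 0 x2 x3 + a0 * phi t x2 x3)%C /\
  p U t 0 x2 x3 = (a * phi t x2 x3)%C.

(** Traces at [x1 = 0] are point values: the fields considered below are
    smooth on the whole space. *)
Definition is_solution (rho c : R) (F2 F3 : idx -> R) (a0 dp : R)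
    (U : unknowns field) (phi : bfield) : Prop :=
  (forall t x1 x2 x3, 0 < t -> 0 < x1 ->
     all_components (fun f => has_partials f t x1 x2 x3) U /\
     interior_equations rho c F2 F3 U t x1 x2 x3) /\
  (forall t x2 x3, 0 < t ->
     ex_Cderive (fun z => phi z x2 x3) t /\
     boundary_conditions a0 dp U phi t x2 x3).

Definition is_trivial (U : unknowns field) (phi : bfield) : Prop :=
  (forall t x1 x2 x3, 0 < t -> 0 < x1 ->
     all_components (fun f : field => f t x1 x2 x3 = 0%C) U) /\
  (forall t x2 x3, 0 < t -> phi t x2 x3 = 0%C).

Definition Cexp (z : C) : C :=
  (exp (Re z) * cos (Im z), exp (Re z) * sin (Im z)).

Definition interior_wave (n : nat) (s lam : C) (w2 w3 : R) (A : C) : field :=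
  fun t x1 x2 x3 =>
    (A * Cexp (INR n * (s * t + lam * x1 + Ci * (w2 * x2 + w3 * x3)%R)))%C.

Definition boundary_wave (n : nat) (s : C) (w2 w3 : R) (A : C) : bfield :=
  fun t x2 x3 =>
    (A * Cexp (INR n * (s * t + Ci * (w2 * x2 + w3 * x3)%R)))%C.

Definition exp_unknowns (n : nat) (s lam : C) (w2 w3 : R)
    (Ubar : unknowns C) : unknowns field :=
  let W := interior_wave n s lam w2 w3 in
  Unknowns (W (p Ubar)) (fun i => W (v Ubar i)) (fun j i => W (F Ubar j i)).

Definition ill_posed (rho c : R) (F2 F3 : idx -> R) (a0 dp : R) : Prop :=
  exists (w2 w3 : R) (Ubar : nat -> unknowns C) (phibar s lam : nat -> C),
    eventually (fun n =>
      0 < Re (s n) /\ Re (lam n) < 0 /\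
      let U := exp_unknowns n (s n) (lam n) w2 w3 (Ubar n) in
      let phi := boundary_wave n (s n) w2 w3 (phibar n) in
      is_solution rho c F2 F3 a0 dp U phi /\ ~ is_trivial U phi) /\
    is_lim_seq (fun n => INR n * Re (s n)) p_infty.

Definition collinear (F2 F3 : idx -> R) : Prop :=
  F2 i1 * F3 i2 - F3 i1 * F2 i2 = 0 /\
  F2 i1 * F3 i3 - F3 i1 * F2 i3 = 0 /\
  F2 i2 * F3 i3 - F3 i2 * F2 i3 = 0.

Lemma collinear_line (F2 F3 : idx -> R) :
  collinear F2 F3 <->
  exists d2 d3 : R, forall j, exists k : R, F2 j = k * d2 /\ F3 j = k * d3.
Proof.
split.
- intros (H12 & H13 & H23).
  assert (line : forall m, F2 m <> 0 \/ F3 m <> 0 ->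
    (forall j, F2 m * F3 j - F3 m * F2 j = 0) ->
    exists d2 d3 : R, forall j, exists k : R, F2 j = k * d2 /\ F3 j = k * d3).
  { intros m Hm H. exists (F2 m), (F3 m). intros j. specialize (H j).
    destruct (Req_dec (F2 m) 0) as [E|E].
    - destruct Hm as [Hm|Hm]; [contradiction|].
      assert (F2 j = 0).
      { rewrite E in H. apply (Rmult_eq_reg_l (F3 m)); lra. }
      exists (F3 j / F3 m). split; [rewrite E; lra | now field].
    - exists (F2 j / F2 m). split; [now field|].
      apply (Rmult_eq_reg_l (F2 m)); [|exact E].
      field_simplify; lra. }
  destruct (Req_dec (F2 i1) 0); destruct (Req_dec (F3 i1) 0);
    try (apply (line i1); [tauto | intros []; lra]).
  destruct (Req_dec (F2 i2) 0); destruct (Req_dec (F3 i2) 0);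
    try (apply (line i2); [tauto | intros []; lra]).
  exists (F2 i3), (F3 i3). intros [].
  + exists 0. lra.
  + exists 0. lra.
  + exists 1. lra.
- intros (d2 & d3 & H).
  destruct (H i1) as (k1 & E1 & E1'), (H i2) as (k2 & E2 & E2'),
    (H i3) as (k3 & E3 & E3').
  unfold collinear. rewrite E1, E1', E2, E2', E3, E3'.
  repeat split; ring.
Qed.

(* Main.v *)
Require Import Defs.
From Stdlib Require Import Reals Lra Lia.
From Coquelicot Require Import Coquelicot.

Open Scope R_scope.

(** An exponential wave solves the problem exactly when its amplitudes solve a
    linear algebraic system ([is_solution_waves]).  Write [l_j = F2 j w2 + F3 j w3]
    and [M = l_1^2 + l_2^2 + l_3^2] (the [stiffness] at the frequency
    [w = (w2, w3)]).  Eliminating [F_j = i l_j v / s], then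
    [v = - s (lam, i w2, i w3) p / (rho (s^2 + M))], then [p = - dp phi], leaves,
    for a nontrivial wave with [Re s > 0] and [n Re s > a0], two scalar
    equations ([dispersion]):
<<
      rho (n s - a0) (s^2 + M) = dp s lam,
      lam^2 = |w|^2 + (s^2 + M) / c^2.
>>
    The question is whether [n Re s] can tend to infinity along solutions of
    these equations with [Re lam < 0].

    - If [M > 0], the two equations force [s^2 + M = O(1/n)]: the roots lie
      within [O(1/n)] of the imaginary points [+- i sqrt M], so [n Re s] is
      bounded ([growth_bounded_stiff]).
    - If [w = 0], then [lam = - s / c] and [n s = a0 - dp / (rho c)]
      ([growth_tangentially_uniform]).
    - If [M = 0] and [dp >= 0], comparing imaginary parts shows that a root
      with [n Re s > |a0|] is real, and then the first equation equates a
      positive number with a nonpositive one ([growth_bounded_stable_sign]).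
    - If [M = 0], [w <> 0] and [dp < 0], the first equation becomes
      [rho (n s - a0) s = |dp| sqrt (|w|^2 + s^2 / c^2)], which has a real root
      of order [n^(-1/2)], the Rayleigh-Taylor balance; hence [n s] grows like
      [n^(1/2)] ([real_root_exists], [real_root_growth]).

    So ill-posedness means [dp < 0] together with the existence of a [w <> 0]
    at which [M] vanishes, that is, of a nonzero vector orthogonal to all three
    [F_j]; in the plane this says that the [F_j] are collinear
    ([collinear_stiffness]). *)

(** * Complex arithmetic *)

Lemma Cmult_reg_l (k a b : C) : k <> 0%C -> (k * a = k * b)%C -> a = b.
Proof.
intros Hk H.
now rewrite <- (Cmult_1_l a), <- (Cmult_1_l b), <- (Cinv_l k Hk),
  <- !Cmult_assoc, H.
Qed.

Lemma Cmult_integral (a b : C) : (a * b)%C = 0%C -> a = 0%C \/ b = 0%C.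
Proof.
intros H; destruct (Ceq_dec a 0) as [E|E]; [now left | right].
apply Cmult_reg_l with a; [exact E | rewrite H; ring].
Qed.

Lemma factor_eq_0 (k L e : C) : k <> 0%C -> L = (k * e)%C -> L = 0%C <-> e = 0%C.
Proof.
intros Hk ->; split; [|intros ->; ring].
intros H; apply Cmult_reg_l with k; [exact Hk | rewrite H; ring].
Qed.

(** * Exponential waves and their derivatives *)

Lemma Cexp_neq_0 (z : C) : Cexp z <> 0%C.
Proof.
intros H; unfold Cexp in H.
injection H as H1 H2.
assert (E := exp_pos (Re z)).
assert (T := sin2_cos2 (Im z)); unfold Rsqr in T.
apply Rmult_integral in H1; apply Rmult_integral in H2.
destruct H1 as [H1|H1]; destruct H2 as [H2|H2]; try lra.
rewrite H1, H2 in T; lra.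
Qed.

Lemma wave_derive (f : R -> C) (A a b : C) (y : R) :
  (forall z : R, f z = A * Cexp (a * z + b))%C ->
  ex_Cderive f y /\ CDerive f y = (a * f y)%C.
Proof.
intros Hf.
destruct A as [A1 A2], a as [a1 a2], b as [b1 b2].
assert (HR : is_derive (fun z => Re (f z)) y (Re ((a1, a2) * f y)%C)).
{ apply is_derive_ext with
    (fun z => A1 * (exp (a1 * z + b1) * cos (a2 * z + b2))
              - A2 * (exp (a1 * z + b1) * sin (a2 * z + b2))).
  - intros t; rewrite Hf; unfold Cexp, Re, Im; simpl.
    replace (a1 * t - a2 * 0 + b1) with (a1 * t + b1) by ring.
    replace (a1 * 0 + a2 * t + b2) with (a2 * t + b2) by ring.
    ring.
  - auto_derive; [easy|].
    rewrite Hf; unfold Cexp, Re, Im; simpl.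
    replace (a1 * y - a2 * 0 + b1) with (a1 * y + b1) by ring.
    replace (a1 * 0 + a2 * y + b2) with (a2 * y + b2) by ring.
    ring. }
assert (HI : is_derive (fun z => Im (f z)) y (Im ((a1, a2) * f y)%C)).
{ apply is_derive_ext with
    (fun z => A1 * (exp (a1 * z + b1) * sin (a2 * z + b2))
              + A2 * (exp (a1 * z + b1) * cos (a2 * z + b2))).
  - intros t; rewrite Hf; unfold Cexp, Re, Im; simpl.
    replace (a1 * t - a2 * 0 + b1) with (a1 * t + b1) by ring.
    replace (a1 * 0 + a2 * t + b2) with (a2 * t + b2) by ring.
    ring.
  - auto_derive; [easy|].
    rewrite Hf; unfold Cexp, Re, Im; simpl.
    replace (a1 * y - a2 * 0 + b1) with (a1 * y + b1) by ring.
    replace (a1 * 0 + a2 * y + b2) with (a2 * y + b2) by ring.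
    ring. }
split.
- split; eexists; [exact HR | exact HI].
- unfold CDerive.
  rewrite (surjective_pairing (_ * _)%C).
  f_equal; apply is_derive_unique; assumption.
Qed.

(** The Fourier-Laplace symbol of [dx k], up to the factor [n]. *)
Definition symbol (lam : C) (w2 w3 : R) (k : idx) : C :=
  match k with
  | i1 => lam
  | i2 => (Ci * w2)%C
  | i3 => (Ci * w3)%C
  end.

Lemma interior_wave_derive (n : nat) (s lam : C) (w2 w3 : R) (A : C)
    (t x1 x2 x3 : R) :
  let f := interior_wave n s lam w2 w3 A in
  has_partials f t x1 x2 x3 /\
  dt f t x1 x2 x3 = (INR n * s * f t x1 x2 x3)%C /\
  (forall k, dx k f t x1 x2 x3
     = (INR n * symbol lam w2 w3 k * f t x1 x2 x3)%C).
Proof.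
intros f.
destruct (wave_derive (fun z => f z x1 x2 x3) A (INR n * s)
  (INR n * (lam * x1 + Ci * (w2 * x2 + w3 * x3)%R))%C t) as [E0 D0].
{ intros z; unfold f, interior_wave; do 2 f_equal; ring. }
destruct (wave_derive (fun z => f t z x2 x3) A (INR n * lam)
  (INR n * (s * t + Ci * (w2 * x2 + w3 * x3)%R))%C x1) as [E1 D1].
{ intros z; unfold f, interior_wave; do 2 f_equal; ring. }
destruct (wave_derive (fun z => f t x1 z x3) A (INR n * (Ci * w2))
  (INR n * (s * t + lam * x1 + Ci * (w3 * x3)%R))%C x2) as [E2 D2].
{ intros z; unfold f, interior_wave; do 2 f_equal;
  rewrite RtoC_plus, !RtoC_mult; ring. }
destruct (wave_derive (fun z => f t x1 x2 z) A (INR n * (Ci * w3))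
  (INR n * (s * t + lam * x1 + Ci * (w2 * x2)%R))%C x3) as [E3 D3].
{ intros z; unfold f, interior_wave; do 2 f_equal;
  rewrite RtoC_plus, !RtoC_mult; ring. }
split; [repeat split; apply E0 || apply E1 || apply E2 || apply E3 |].
split; [exact D0 | intros []; assumption].
Qed.

Lemma boundary_wave_derive (n : nat) (s : C) (w2 w3 : R) (A : C)
    (t x2 x3 : R) :
  let f := boundary_wave n s w2 w3 A in
  ex_Cderive (fun z => f z x2 x3) t /\
  CDerive (fun z => f z x2 x3) t = (INR n * s * f t x2 x3)%C.
Proof.
intros f.
apply (wave_derive (fun z => f z x2 x3) A (INR n * s)
  (INR n * (Ci * (w2 * x2 + w3 * x3)%R))%C t).
intros z; unfold f, boundary_wave; do 2 f_equal; ring.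
Qed.

Lemma interior_wave_trace (n : nat) (s lam : C) (w2 w3 : R) (A : C)
    (t x2 x3 : R) :
  interior_wave n s lam w2 w3 A t 0 x2 x3 = boundary_wave n s w2 w3 A t x2 x3.
Proof.
unfold interior_wave, boundary_wave; do 2 f_equal; ring.
Qed.

(** * Amplitude equations *)

(** [Ci] times this is the symbol of [Lop F2 F3 j], up to the factor [n]. *)
Definition Lop_frequency (F2 F3 : idx -> R) (w2 w3 : R) (j : idx) : R :=
  F2 j * w2 + F3 j * w3.

Record amplitude_equations (rho c : R) (F2 F3 : idx -> R) (a0 dp w2 w3 : R)
    (n : nat) (s lam : C) (U : unknowns C) (phi : C) : Prop := {
  amp_p : ((1 / (rho * c ^ 2))%R * s * p U
    + sum3 (fun k => symbol lam w2 w3 k * v U k) = 0)%C;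
  amp_v : forall i, (rho * s * v U i + symbol lam w2 w3 i * p U
    - rho * sum3 (fun j => Ci * Lop_frequency F2 F3 w2 w3 j * F U j i) = 0)%C;
  amp_F : forall j i,
    (s * F U j i - Ci * Lop_frequency F2 F3 w2 w3 j * v U i = 0)%C;
  amp_front : (INR n * s * phi = v U i1 + a0 * phi)%C;
  amp_pressure : p U = ((- dp)%R * phi)%C }.

(** The system has constant coefficients, so on a wave of a single frequency
    every equation is its amplitude equation times an exponential; one point
    in the interior and one on the boundary therefore decide it everywhere. *)
Lemma is_solution_waves (rho c : R) (F2 F3 : idx -> R) (a0 dp w2 w3 : R)
    (n : nat) (s lam : C) (U : unknowns C) (phi : C) :
  (0 < n)%nat ->
  is_solution rho c F2 F3 a0 dp
    (exp_unknowns n s lam w2 w3 U) (boundary_wave n s w2 w3 phi) <->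
  amplitude_equations rho c F2 F3 a0 dp w2 w3 n s lam U phi.
Proof.
intros Hn.
assert (Hn' : RtoC (INR n) <> 0%C).
{ intros H; apply RtoC_inj in H; apply lt_0_INR in Hn; lra. }
assert (HI : forall t x1 x2 x3, exists E : C, (INR n * E <> 0)%C /\
  forall A, interior_wave n s lam w2 w3 A t x1 x2 x3 = (E * A)%C).
{ intros t x1 x2 x3; eexists; split; [apply Cmult_neq_0; [exact Hn'|] |].
  2: { intros A; unfold interior_wave; rewrite Cmult_comm; reflexivity. }
  apply Cexp_neq_0. }
assert (HB : forall t x2 x3, exists E : C, E <> 0%C /\
  forall A, boundary_wave n s w2 w3 A t x2 x3 = (E * A)%C).
{ intros t x2 x3; eexists; split.
  2: { intros A; unfold boundary_wave; rewrite Cmult_comm; reflexivity. }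
  apply Cexp_neq_0. }
assert (Int : forall t x1 x2 x3,
  interior_equations rho c F2 F3 (exp_unknowns n s lam w2 w3 U) t x1 x2 x3 <->
  (((1 / (rho * c ^ 2))%R * s * p U
    + sum3 (fun k => symbol lam w2 w3 k * v U k) = 0)%C /\
  (forall i, (rho * s * v U i + symbol lam w2 w3 i * p U
    - rho * sum3 (fun j => Ci * Lop_frequency F2 F3 w2 w3 j * F U j i) = 0)%C) /\
  (forall j i,
    (s * F U j i - Ci * Lop_frequency F2 F3 w2 w3 j * v U i = 0)%C))).
{ intros t x1 x2 x3; destruct (HI t x1 x2 x3) as (E & HE & WE).
  assert (Dt : forall A, dt (interior_wave n s lam w2 w3 A) t x1 x2 x3
    = (INR n * s * (E * A))%C).
  { intros A; rewrite <- WE; apply interior_wave_derive. }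
  assert (Dx : forall k A, dx k (interior_wave n s lam w2 w3 A) t x1 x2 x3
    = (INR n * symbol lam w2 w3 k * (E * A))%C).
  { intros k A; rewrite <- WE; apply interior_wave_derive. }
  assert (DL : forall j A, Lop F2 F3 j (interior_wave n s lam w2 w3 A) t x1 x2 x3
    = (INR n * (Ci * Lop_frequency F2 F3 w2 w3 j) * (E * A))%C).
  { intros j A; unfold Lop; rewrite !Dx; unfold symbol, Lop_frequency.
    rewrite RtoC_plus, !RtoC_mult; ring. }
  unfold interior_equations, exp_unknowns, sum3; simpl p; simpl v; simpl F.
  assert (and3 : forall P P' Q Q' R R' : Prop, P <-> P' -> Q <-> Q' ->
    R <-> R' -> P /\ Q /\ R <-> P' /\ Q' /\ R') by tauto.
  assert (all_iff : forall P Q : idx -> Prop, (forall i, P i <-> Q i) ->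
    (forall i, P i) <-> (forall i, Q i))
    by (intros P Q H; split; intros K i; apply H, K).
  apply and3.
  - apply factor_eq_0 with (INR n * E)%C; [exact HE|]; rewrite Dt, !Dx; ring.
  - apply all_iff; intros i.
    apply factor_eq_0 with (INR n * E)%C; [exact HE|]; rewrite Dt, Dx, !DL; ring.
  - apply all_iff; intros j; apply all_iff; intros i.
    apply factor_eq_0 with (INR n * E)%C; [exact HE|]; rewrite Dt, DL; ring. }
assert (Bd : forall t x2 x3,
  boundary_conditions a0 dp (exp_unknowns n s lam w2 w3 U)
    (boundary_wave n s w2 w3 phi) t x2 x3 <->
  ((INR n * s * phi = v U i1 + a0 * phi)%C /\ p U = ((- dp)%R * phi)%C)).
{ intros t x2 x3; destruct (HB t x2 x3) as (E & HE & WE).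
  unfold boundary_conditions, exp_unknowns; simpl p; simpl v.
  rewrite !interior_wave_trace.
  rewrite (proj2 (boundary_wave_derive n s w2 w3 phi t x2 x3)), !WE.
  split; intros [H1 H2]; split.
  - apply (Cmult_reg_l E _ _ HE); transitivity (INR n * s * (E * phi))%C; [ring|].
    rewrite H1; ring.
  - apply (Cmult_reg_l E _ _ HE); rewrite H2; ring.
  - transitivity (E * (INR n * s * phi))%C; [ring|].
    rewrite H1; ring.
  - rewrite H2; ring. }
split.
- intros [H1 H2].
  destruct (H1 1 1 0 0) as [_ H1']; try lra.
  destruct (H2 1 0 0) as [_ H2']; try lra.
  apply Int in H1' as (? & ? & ?); apply Bd in H2' as (? & ?).
  now split.
- intros [? ? ? ? ?]; split.
  + intros t x1 x2 x3 _ _; split; [|apply Int; auto].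
    split; [|split]; intros; apply interior_wave_derive.
  + intros t x2 x3 _; split; [apply boundary_wave_derive | apply Bd; auto].
Qed.

(** * Dispersion relations *)

(** Up to the factor [n^2], minus the symbol of the sum of the squares of the
    [Lop F2 F3 j]: the elastic restoring force per unit mass and unit
    displacement at the frequency [(w2, w3)]. *)
Definition stiffness (F2 F3 : idx -> R) (w2 w3 : R) : R :=
  Lop_frequency F2 F3 w2 w3 i1 * Lop_frequency F2 F3 w2 w3 i1
  + Lop_frequency F2 F3 w2 w3 i2 * Lop_frequency F2 F3 w2 w3 i2
  + Lop_frequency F2 F3 w2 w3 i3 * Lop_frequency F2 F3 w2 w3 i3.

(** The first equation is the front condition, the second the wave equation for
    the pressure; [M] stands for the stiffness and [W] for [w2^2 + w3^2]. *)
Definition dispersion (rho c a0 dp M W : R) (n : nat) (s lam : C) : Prop :=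
  (rho * (INR n * s - a0) * (s * s + M) = dp * s * lam)%C /\
  (c * c * (lam * lam - W) = s * s + M)%C.

Lemma Re_pos_neq_0 (s : C) : 0 < Re s -> s <> 0%C.
Proof. intros H ->; unfold Re in H; simpl in H; lra. Qed.

Lemma Re_pos_square_plus_neq_0 (s : C) (M : R) :
  0 < Re s -> 0 <= M -> (s * s + M)%C <> 0%C.
Proof.
destruct s as [x y]; unfold Re; simpl; intros Hx HM H.
injection H as H1 H2.
assert (x * y = 0) by lra.
apply Rmult_integral in H as [H|H]; [lra|].
rewrite H in H1; nra.
Qed.

Lemma Ci_square : (Ci * Ci = - (1))%C.
Proof. unfold Ci; apply injective_projections; simpl; ring. Qed.

Lemma stiffness_nonneg (F2 F3 : idx -> R) (w2 w3 : R) : 0 <= stiffness F2 F3 w2 w3.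
Proof. unfold stiffness; nra. Qed.

Lemma RtoC_stiffness (F2 F3 : idx -> R) (w2 w3 : R) :
  RtoC (stiffness F2 F3 w2 w3)
  = (Lop_frequency F2 F3 w2 w3 i1 * Lop_frequency F2 F3 w2 w3 i1
     + Lop_frequency F2 F3 w2 w3 i2 * Lop_frequency F2 F3 w2 w3 i2
     + Lop_frequency F2 F3 w2 w3 i3 * Lop_frequency F2 F3 w2 w3 i3)%C.
Proof. unfold stiffness; now rewrite !RtoC_plus, !RtoC_mult. Qed.

(** With [s] and [s^2 + M] nonzero, the components of [v] and [F] are multiples
    of [p]; with [n s <> a0], a wave with [p = 0], hence [v = 0], also has
    [phi = 0].  Hence a nontrivial wave has [p <> 0] and [phi <> 0], and these
    factors cancel from the two scalar equations left by the elimination. *)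
Lemma amplitude_dispersion (rho c : R) (F2 F3 : idx -> R) (a0 dp w2 w3 : R)
    (n : nat) (s lam : C) (U : unknowns C) (phi : C) :
  0 < rho -> 0 < c -> 0 < Re s -> a0 < INR n * Re s ->
  amplitude_equations rho c F2 F3 a0 dp w2 w3 n s lam U phi ->
  ~ (all_components (fun A : C => A = 0%C) U /\ phi = 0%C) ->
  dispersion rho c a0 dp (stiffness F2 F3 w2 w3) (w2 * w2 + w3 * w3) n s lam.
Proof.
intros Hrho Hc Hs Hgrow [Ep Ev EF Efront Epress] Hnon.
set (M := stiffness F2 F3 w2 w3).
assert (Hs0 := Re_pos_neq_0 s Hs).
assert (Hq := Re_pos_square_plus_neq_0 s M Hs (stiffness_nonneg _ _ _ _)).
assert (Hrho' : RtoC rho <> 0%C) by (intros H; apply RtoC_inj in H; lra).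
assert (Hfront : (INR n * s - a0)%C <> 0%C).
{ intros H; apply (f_equal Re) in H; revert H.
  unfold Re in *; simpl; intros H; lra. }
assert (HM := RtoC_stiffness F2 F3 w2 w3); fold M in HM.
(* The velocity in terms of the pressure: multiply the momentum equation by [s]
   and eliminate [F]. *)
assert (Vel : forall i,
  (rho * (s * s + M) * v U i = - (s * symbol lam w2 w3 i * p U))%C).
{ intros i.
  assert (E := Ev i); unfold sum3 in E; cbv beta in E.
  assert (F1' := EF i1 i); assert (F2' := EF i2 i); assert (F3' := EF i3 i).
  assert (Z : forall x y : C, (x - y = 0)%C -> x = y).
  { intros x y H; transitivity (x - y + y)%C; [ring | rewrite H; ring]. }
  apply Z in F1', F2', F3'; apply Z.
  transitivity (s * (rho * s * v U i + symbol lam w2 w3 i * p U)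
    - rho * (Ci * Lop_frequency F2 F3 w2 w3 i1 *
        (Ci * Lop_frequency F2 F3 w2 w3 i1 * v U i)
     + Ci * Lop_frequency F2 F3 w2 w3 i2 *
        (Ci * Lop_frequency F2 F3 w2 w3 i2 * v U i)
     + Ci * Lop_frequency F2 F3 w2 w3 i3 *
        (Ci * Lop_frequency F2 F3 w2 w3 i3 * v U i)))%C.
  { rewrite HM; ring [Ci_square]. }
  rewrite <- F1', <- F2', <- F3'.
  transitivity (s * 0)%C; [rewrite <- E; ring | ring]. }
assert (Hpress : p U <> 0%C).
{ intros P0; apply Hnon.
  assert (V0 : forall i, v U i = 0%C).
  { intros i; assert (E := Vel i); rewrite P0 in E.
    destruct (Cmult_integral (rho * (s * s + M)) (v U i)) as [H|H];
      [rewrite E; ring | | exact H].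
    apply Cmult_integral in H; tauto. }
  repeat split.
  - exact P0.
  - exact V0.
  - intros j i; assert (E := EF j i); rewrite V0 in E.
    destruct (Cmult_integral s (F U j i)) as [H|H]; [|tauto|exact H].
    rewrite <- E; ring.
  - rewrite V0 in Efront.
    destruct (Cmult_integral (INR n * s - a0) phi) as [H|H];
      [|tauto|exact H].
    transitivity (INR n * s * phi - a0 * phi)%C; [ring|].
    rewrite Efront; ring. }
assert (Hphi : phi <> 0%C) by (intros H; apply Hpress; rewrite Epress, H; ring).
split.
- apply Cmult_reg_l with phi; [exact Hphi|].
  transitivity (rho * (s * s + M) * (INR n * s * phi - a0 * phi))%C; [ring|].
  rewrite Efront.
  transitivity (rho * (s * s + M) * v U i1)%C; [ring|].
  rewrite Vel, Epress, RtoC_opp; unfold symbol; ring.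
- apply Cmult_reg_l with (s * p U)%C; [now apply Cmult_neq_0|].
  unfold sum3 in Ep.
  set (k := RtoC (1 / (rho * c ^ 2))) in Ep.
  assert (Hk : (k * (rho * (c * c)) = 1)%C).
  { unfold k; rewrite <- !RtoC_mult; f_equal; field; lra. }
  assert (E : (c * c * (k * s * p U * (rho * (s * s + M))
    + (symbol lam w2 w3 i1 * (rho * (s * s + M) * v U i1)
    + symbol lam w2 w3 i2 * (rho * (s * s + M) * v U i2)
    + symbol lam w2 w3 i3 * (rho * (s * s + M) * v U i3))) = 0)%C).
  { transitivity (c * c * (rho * (s * s + M)) * 0)%C;
      [rewrite <- Ep; ring | ring]. }
  rewrite !Vel in E; unfold symbol in E.
  rewrite RtoC_plus, !RtoC_mult.
  transitivity (s * p U * (c * c * (lam * lam - (w2 * w2 + w3 * w3))) + 0)%C;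
    [ring|].
  rewrite <- E.
  transitivity ((k * (rho * (c * c))) * (s * p U * (s * s + M)))%C.
  { ring [Ci_square]. }
  rewrite Hk; ring.
Qed.

(** The elimination run backwards, normalized by [phi = 1].  It is stated with a
    sigma type because one wave has to be selected for each [n]. *)
Lemma dispersion_amplitude (rho c : R) (F2 F3 : idx -> R) (a0 dp w2 w3 : R)
    (n : nat) (s lam : C) :
  0 < rho -> 0 < c -> 0 < Re s ->
  dispersion rho c a0 dp (stiffness F2 F3 w2 w3) (w2 * w2 + w3 * w3) n s lam ->
  {U : unknowns C | amplitude_equations rho c F2 F3 a0 dp w2 w3 n s lam U 1}.
Proof.
intros Hrho Hc Hs [D1 D2].
set (M := stiffness F2 F3 w2 w3) in *.
assert (Hs0 := Re_pos_neq_0 s Hs).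
assert (Hq := Re_pos_square_plus_neq_0 s M Hs (stiffness_nonneg _ _ _ _)).
fold M in Hq.
assert (Hrho' : RtoC rho <> 0%C) by (intros H; apply RtoC_inj in H; lra).
assert (HM := RtoC_stiffness F2 F3 w2 w3); fold M in HM.
(* [v = g (lam, i w2, i w3)] for the pressure amplitude [- dp]. *)
set (g := (s * dp / (rho * (s * s + M)))%C).
assert (Hg : (rho * (s * s + M) * g = s * dp)%C) by (unfold g; now field).
assert (Hg1 : (g * lam = INR n * s - a0)%C).
{ unfold g; transitivity (dp * s * lam / (rho * (s * s + M)))%C;
    [now field | rewrite <- D1; now field]. }
exists (Unknowns (RtoC (- dp)) (fun i => (g * symbol lam w2 w3 i)%C)
  (fun j i => (Ci * Lop_frequency F2 F3 w2 w3 j * (g * symbol lam w2 w3 i) / s)%C)).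
split; simpl p; simpl v; simpl F.
- assert (Hc' : RtoC c <> 0%C) by (intros H; apply RtoC_inj in H; lra).
  replace (RtoC (1 / (rho * c ^ 2))) with (/ (rho * (c * c)))%C.
  2: { rewrite <- !RtoC_mult, <- RtoC_inv
         by (apply Rgt_not_eq; repeat apply Rmult_lt_0_compat; lra).
       apply (f_equal RtoC); field; lra. }
  unfold sum3, symbol; rewrite RtoC_opp.
  rewrite RtoC_plus, !RtoC_mult in D2.
  transitivity (/ (rho * (c * c)) * (- (s * dp)) +
    g * (lam * lam - (w2 * w2 + w3 * w3)))%C; [ring [Ci_square]|].
  rewrite <- Hg.
  transitivity (g / (c * c) *
    (c * c * (lam * lam - (w2 * w2 + w3 * w3)) - (s * s + M)))%C;
    [now field|].
  rewrite D2; ring.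
- intros i; unfold sum3; rewrite RtoC_opp.
  transitivity (symbol lam w2 w3 i / s * (rho * (s * s + M) * g - s * dp))%C.
  { rewrite HM.
    field_simplify_eq [Ci_square]; [|assumption].
    ring [Ci_square]. }
  rewrite Hg; ring.
- intros j i; now field.
- rewrite Hg1; ring.
- ring.
Qed.

(** * Bounded growth *)

(** In moduli, once [n Re s > 2 |a0|] the front condition gives
    [n |s^2 + M| <= (2 |dp| / rho) |lam|], and the pressure equation bounds
    [|lam|^2] by an affine function of [|s^2 + M|].  Together they bound
    [n |s^2 + M|], while [|s^2 + M| >= sqrt M Re s] in the right half-plane. *)
Lemma growth_bounded_stiff (rho c a0 dp M W : R) :
  0 < rho -> 0 < c -> 0 < M -> 0 <= W ->
  exists B, forall n s lam, (0 < n)%nat -> 0 < Re s ->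
    dispersion rho c a0 dp M W n s lam -> INR n * Re s <= B.
Proof.
intros Hrho Hc HM HW.
set (mu := sqrt M).
assert (Hmu : 0 < mu) by now apply sqrt_lt_R0.
assert (Hmu2 : mu * mu = M) by (apply sqrt_sqrt; lra).
(* Where [X = n |s^2 + M|] exceeds [1], the two estimates give [X^2 <= L X], so
   [X <= 1 + L] always. *)
set (L := 4 * (dp * dp) * (W + / (c * c)) / (rho * rho)).
exists (2 * Rabs a0 + (1 + L) / mu).
intros n s lam Hn Hs [D1 D2].
assert (Hn1 : 1 <= INR n) by (apply (le_INR 1); exact Hn).
assert (Hcc : 0 < / (c * c)) by (apply Rinv_0_lt_compat; nra).
assert (HL : 0 <= L).
{ unfold L, Rdiv; apply Rmult_le_pos; [apply Rmult_le_pos; nra|].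
  apply Rlt_le, Rinv_0_lt_compat; nra. }
assert (HKmu : 0 < (1 + L) / mu) by (apply Rdiv_lt_0_compat; lra).
assert (Ha0 := Rabs_pos a0).
destruct (Rle_dec (INR n * Re s) (2 * Rabs a0)) as [Hsmall|Hlarge]; [lra|].
apply Rnot_le_lt in Hlarge.
set (q := Cmod (s * s + M)%C).
assert (Hq : 0 <= q) by apply Cmod_ge_0.
assert (Hre : Re s <= Cmod s)
  by (eapply Rle_trans; [apply Rle_abs | apply re_le_Cmod]).
assert (Hmod : 0 < Cmod s) by lra.
(* The front factor [n s - a0] has modulus at least
   [n |s| / 2], and [|s|] cancels. *)
assert (E1 : rho * INR n * q <= 2 * Rabs dp * Cmod lam).
{ apply (f_equal Cmod) in D1; rewrite !Cmod_mult, !Cmod_R in D1.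
  fold q in D1; rewrite (Rabs_pos_eq rho) in D1 by lra.
  assert (T : INR n * Cmod s <= Cmod (INR n * s - a0)%C + Rabs a0).
  { replace (INR n * Cmod s) with (Cmod (INR n * s)%C)
      by (rewrite Cmod_mult, Cmod_R, Rabs_pos_eq; lra).
    rewrite <- (Cmod_R a0).
    replace (INR n * s)%C with ((INR n * s - a0) + a0)%C at 1 by ring.
    apply Cmod_triangle. }
  assert (T2 : INR n * Cmod s <= 2 * Cmod (INR n * s - a0)%C) by nra.
  apply Rmult_le_reg_r with (Cmod s); [exact Hmod|].
  apply Rle_trans with (2 * (rho * Cmod (INR n * s - a0)%C * q)).
  - assert (0 <= rho * q) by nra; nra.
  - rewrite D1; lra. }
assert (E2 : Cmod lam * Cmod lam <= W + q * / (c * c)).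
{ rewrite <- Cmod_mult.
  replace (lam * lam)%C with (W + (s * s + M) * RtoC (/ (c * c)))%C.
  - eapply Rle_trans; [apply Cmod_triangle|].
    rewrite Cmod_mult, !Cmod_R, !Rabs_pos_eq by lra.
    apply Rle_refl.
  - rewrite <- D2.
    transitivity (W + RtoC (c * c * / (c * c)) * (lam * lam - W))%C.
    + rewrite !RtoC_mult; ring.
    + rewrite Rinv_r by nra; ring. }
assert (E3 : INR n * q <= 1 + L).
{ set (X := INR n * q) in *.
  destruct (Rle_dec X 1) as [H|H]; [lra|]; apply Rnot_le_lt in H.
  assert (Hx : q <= X) by (unfold X; nra).
  assert (Hdp : Rabs dp * Rabs dp = dp * dp)
    by (rewrite <- Rabs_mult; apply Rabs_pos_eq; nra).
  assert (Hl := Cmod_ge_0 lam).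
  assert (Hd := Rabs_pos dp).
  assert (S : (rho * X) * (rho * X)
    <= (2 * Rabs dp * Cmod lam) * (2 * Rabs dp * Cmod lam)).
  { assert (0 <= rho * X) by nra.
    assert (rho * X <= 2 * Rabs dp * Cmod lam) by (unfold X; lra).
    apply Rmult_le_compat; assumption. }
  assert (S2 : (rho * rho) * X * X <= 4 * (dp * dp) * (W + / (c * c)) * X).
  { apply Rle_trans with (4 * (dp * dp) * (Cmod lam * Cmod lam)).
    - rewrite <- Hdp; lra.
    - rewrite (Rmult_assoc (4 * (dp * dp))); apply Rmult_le_compat_l; [nra|].
      eapply Rle_trans; [exact E2|].
      nra. }
  apply Rmult_le_reg_r in S2; [|lra].
  assert (L * (rho * rho) = 4 * (dp * dp) * (W + / (c * c)))
    by (unfold L; field; lra).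
  nra. }
(* [s^2 + M = (s - i mu) (s + i mu)]: for [Re s > 0] both factors have modulus
   at least [Re s], and one of them has modulus at least [mu]. *)
assert (E4 : Re s * mu <= q).
{ unfold q, Cmod; destruct s as [x y]; unfold Re in *; simpl in *.
  rewrite <- (sqrt_square (x * mu)) by nra.
  apply sqrt_le_1_alt.
  rewrite <- Hmu2.
  assert (0 <= x * x * (x * x + 2 * (y * y) + mu * mu)
    + (y * y - mu * mu) * (y * y - mu * mu)).
  { apply Rplus_le_le_0_compat; [|apply Rle_0_sqr].
    apply Rmult_le_pos; nra. }
  lra. }
assert (INR n * Re s <= (1 + L) / mu).
{ apply Rmult_le_reg_r with mu; [exact Hmu|].
  replace ((1 + L) / mu * mu) with (1 + L) by (field; lra).
  nra. }
lra.
Qed.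

(** Without tangential variation [lam = +- s / c], and the signs of [Re s] and
    [Re lam] select [lam = - s / c]; the front condition is then linear in
    [n s]. *)
Lemma growth_tangentially_uniform (rho c a0 dp : R) (n : nat) (s lam : C) :
  0 < rho -> 0 < c -> 0 < Re s -> Re lam < 0 ->
  dispersion rho c a0 dp 0 0 n s lam -> INR n * Re s = a0 - dp / (rho * c).
Proof.
intros Hrho Hc Hs Hlam [D1 D2].
assert (Hs0 := Re_pos_neq_0 s Hs).
assert (E : (c * lam = - s)%C).
{ destruct (Cmult_integral (c * lam - s) (c * lam + s)) as [H|H].
  - transitivity (c * c * (lam * lam - RtoC 0) - (s * s + RtoC 0))%C; [ring|].
    rewrite D2; ring.
  - apply (f_equal Re) in H; revert H Hs Hlam.
    destruct s, lam; unfold Re; simpl; intros; nra.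
  - transitivity (c * lam + s - s)%C; [ring | rewrite H; ring]. }
destruct (Cmult_integral (s * s) (c * rho * (INR n * s - a0) + dp)) as [H|H].
- transitivity (c * (rho * (INR n * s - a0) * (s * s + RtoC 0)) + dp * s * s)%C;
    [ring|].
  rewrite D1; transitivity (dp * s * (c * lam + s))%C; [ring|].
  rewrite E; ring.
- apply Cmult_integral in H; tauto.
- apply (f_equal Re) in H; revert H.
  destruct s as [x y]; unfold Re; simpl; intros H.
  apply Rmult_eq_reg_l with (c * rho); [|nra].
  transitivity (c * rho * a0 - dp); [lra | field; lra].
Qed.

(** Put [s = x + i y] and [lam = l1 + i l2].  If [n x > |a0|], the imaginary part
    of the front condition gives [dp l2] the sign of [y], whereas the pressure
    equation [c^2 l1 l2 = x y] with [l1 < 0 < x] makes [l2 y <= 0]; so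
    [y = 0].  The real part then equates a positive number with
    [dp l1 <= 0]. *)
Lemma growth_bounded_stable_sign (rho c a0 dp W : R) (n : nat) (s lam : C) :
  0 < rho -> 0 < c -> 0 <= dp -> 0 < Re s -> Re lam < 0 ->
  dispersion rho c a0 dp 0 W n s lam -> INR n * Re s <= Rabs a0.
Proof.
intros Hrho Hc Hdp Hs Hlam [D1 D2].
assert (Hs0 := Re_pos_neq_0 s Hs).
destruct (Cmult_integral s (rho * (INR n * s - a0) * s - dp * lam)) as [H|H].
{ transitivity (rho * (INR n * s - a0) * (s * s + RtoC 0) - dp * s * lam)%C;
    [ring | rewrite D1; ring]. }
{ contradiction. }
apply Rnot_lt_le; intros Hlarge.
assert (Ha0 := Rle_abs a0); assert (Ha0' := Rabs_pos a0).
destruct s as [x y], lam as [l1 l2]; unfold Re in *; simpl in *.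
injection H as H1 H2; injection D2 as _ H3.
assert (H3' : c * c * l1 * l2 = x * y) by lra.
assert (H2' : rho * (2 * (INR n * x) - a0) * y = dp * l2) by lra.
assert (Hy : y * (rho * (2 * (INR n * x) - a0) * (c * c) * (- l1) + dp * x) = 0).
{ transitivity (dp * (x * y)
    - (rho * (2 * (INR n * x) - a0) * y) * (c * c * l1)); [ring|].
  rewrite H2', <- H3'; ring. }
assert (0 < rho * (2 * (INR n * x) - a0) * (c * c) * (- l1)).
{ repeat apply Rmult_lt_0_compat; lra. }
assert (y = 0).
{ apply Rmult_integral in Hy as [Hy|Hy]; [exact Hy | nra]. }
subst y.
assert (0 < rho * (INR n * x - a0) * x) by (repeat apply Rmult_lt_0_compat; lra).
nra.
Qed.

(** * Unbounded growth *)

(** A sum of squares vanishes only if each [F2 j w2 + F3 j w3] does, so the right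
    side asks for a nonzero vector orthogonal to the three [F_j] in the
    plane. *)
Lemma collinear_stiffness (F2 F3 : idx -> R) :
  collinear F2 F3 <->
  exists w2 w3, 0 < w2 * w2 + w3 * w3 /\ stiffness F2 F3 w2 w3 = 0.
Proof.
split.
- intros H; apply collinear_line in H as (d2 & d3 & H).
  assert (B : forall w2 w3, d2 * w2 + d3 * w3 = 0 -> stiffness F2 F3 w2 w3 = 0).
  { intros w2 w3 E; unfold stiffness.
    assert (T : forall j, Lop_frequency F2 F3 w2 w3 j = 0).
    { intros j; destruct (H j) as (k & H2 & H3); unfold Lop_frequency.
      rewrite H2, H3; transitivity (k * (d2 * w2 + d3 * w3)); [ring|].
      rewrite E; ring. }
    rewrite !T; ring. }
  destruct (Req_dec d2 0) as [Z2|Z2]; [destruct (Req_dec d3 0) as [Z3|Z3]|].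
  + exists 1, 0; split; [lra | apply B; rewrite Z2, Z3; ring].
  + exists (- d3), d2; split; [nra | apply B; ring].
  + exists (- d3), d2; split; [nra | apply B; ring].
- intros (w2 & w3 & Hw & B); unfold stiffness in B.
  assert (T : forall j, F2 j * w2 + F3 j * w3 = 0).
  { assert (squares : forall x y z, x * x + y * y + z * z = 0 ->
      x = 0 /\ y = 0 /\ z = 0).
    { intros x y z E.
      assert (Px := Rle_0_sqr x); assert (Py := Rle_0_sqr y);
        assert (Pz := Rle_0_sqr z); unfold Rsqr in *.
      repeat split; apply Rsqr_0_uniq; unfold Rsqr; lra. }
    destruct (squares _ _ _ B) as (T1 & T2 & T3).
    intros []; assumption. }
  assert (D : forall j k, F2 j * F3 k - F3 j * F2 k = 0).
  { intros j k; assert (Tj := T j); assert (Tk := T k).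
    apply Rmult_eq_reg_l with (w2 * w2 + w3 * w3); [|lra].
    (* [|w|^2] times the determinant of [F_j] and [F_k] lies in the ideal
       generated by their products with [w]. *)
    transitivity ((F2 j * w2 + F3 j * w3) * (F3 k * w2 - F2 k * w3)
      - (F2 k * w2 + F3 k * w3) * (F3 j * w2 - F2 j * w3)); [ring|].
    rewrite Tj, Tk; ring. }
  repeat split; apply D.
Qed.

Lemma square_ratio_nonneg (x c : R) : 0 < c -> 0 <= x * x / (c * c).
Proof.
intros Hc; unfold Rdiv; apply Rmult_le_pos; [nra|].
apply Rlt_le, Rinv_0_lt_compat; nra.
Qed.

(** For real [s] the decaying branch is [lam = - sqrt (W + s^2 / c^2)]. *)
Lemma dispersion_real_root (rho c a0 dp W : R) (n : nat) (s : R) :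
  0 < c -> 0 < W ->
  rho * (INR n * s - a0) * s + dp * sqrt (W + s * s / (c * c)) = 0 ->
  dispersion rho c a0 dp 0 W n s (- sqrt (W + s * s / (c * c)))%R.
Proof.
intros Hc HW H.
assert (Hpos : 0 <= s * s / (c * c)) by now apply square_ratio_nonneg.
set (r := sqrt (W + s * s / (c * c))) in *.
assert (Hr : r * r = W + s * s / (c * c)) by (apply sqrt_sqrt; lra).
split.
- rewrite <- !RtoC_mult, <- RtoC_minus, <- !RtoC_plus, <- !RtoC_mult.
  apply (f_equal RtoC).
  transitivity (s * (rho * (INR n * s - a0) * s + dp * r) - s * (dp * r));
    [ring | rewrite H; ring].
- rewrite <- !RtoC_mult, <- RtoC_minus, <- !RtoC_plus, <- !RtoC_mult.
  apply (f_equal RtoC).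
  replace (- r * - r) with (W + s * s / (c * c)) by lra.
  field; lra.
Qed.

(** Multiplied by [n], the equation reads
    [rho (n s - a0) (n s) = n |dp| sqrt (W + s^2 / c^2) >= n |dp| sqrt W]:
    the left side would stay bounded if [n s] did. *)
Lemma real_root_growth (rho c a0 dp W B : R) :
  0 < rho -> 0 < c -> dp < 0 -> 0 < W -> 0 <= B ->
  exists N, forall n s, (N <= n)%nat -> 0 <= s ->
    rho * (INR n * s - a0) * s + dp * sqrt (W + s * s / (c * c)) = 0 ->
    B < INR n * s.
Proof.
intros Hrho Hc Hdp HW HB.
assert (HwW : 0 < sqrt W) by now apply sqrt_lt_R0.
destruct (INR_unbounded (rho * (B + Rabs a0) * B / (- dp * sqrt W)))
  as [N HN].
exists N; intros n s Hn Hs H.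
apply Rnot_le_lt; intros Hle.
assert (HnN : INR N <= INR n) by now apply le_INR.
assert (Hs2 : 0 <= s * s / (c * c)) by now apply square_ratio_nonneg.
assert (Hsq : sqrt W <= sqrt (W + s * s / (c * c)))
  by (apply sqrt_le_1_alt; lra).
set (r := sqrt (W + s * s / (c * c))) in *.
assert (Hn0 := pos_INR n).
assert (Ha0 := Rle_abs (- a0)); rewrite Rabs_Ropp in Ha0.
assert (E : rho * (INR n * s - a0) * (INR n * s) = INR n * (- dp * r)).
{ transitivity (INR n * (rho * (INR n * s - a0) * s + dp * r)
    - INR n * (dp * r)); [ring | rewrite H; ring]. }
assert (U : rho * (INR n * s - a0) * (INR n * s) <= rho * (B + Rabs a0) * B).
{ assert (0 <= INR n * s) by nra.
  assert (HA := Rabs_pos a0).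
  apply Rle_trans with (rho * (B + Rabs a0) * (INR n * s)).
  - apply Rmult_le_compat_r; [assumption|].
    apply Rmult_le_compat_l; lra.
  - apply Rmult_le_compat_l; [apply Rmult_le_pos; lra | assumption]. }
assert (V : INR n * (- dp * sqrt W) <= INR n * (- dp * r)).
{ apply Rmult_le_compat_l; [assumption|].
  apply Rmult_le_compat_l; lra. }
assert (K : 0 < - dp * sqrt W) by (apply Rmult_lt_0_compat; lra).
apply (Rmult_lt_compat_r (- dp * sqrt W)) in HN; [|exact K].
unfold Rdiv in HN; rewrite Rmult_assoc, Rinv_l, Rmult_1_r in HN by lra.
assert (INR N * (- dp * sqrt W) <= INR n * (- dp * sqrt W))
  by (apply Rmult_le_compat_r; lra).
lra.
Qed.

(** Intermediate value theorem between [0] and [1]; the lower bound on [n] is the sign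
    condition at [s = 1].  The sigma type allows one root to be selected for
    each [n]. *)
Lemma real_root_exists (rho c a0 dp W : R) (n : nat) :
  0 < rho -> 0 < c -> dp < 0 -> 0 < W ->
  a0 - dp * sqrt (W + 1 * 1 / (c * c)) / rho < INR n ->
  {s : R | 0 < s /\
    rho * (INR n * s - a0) * s + dp * sqrt (W + s * s / (c * c)) = 0}.
Proof.
intros Hrho Hc Hdp HW Hn.
assert (Hrad : forall s, 0 < W + s * s / (c * c)).
{ intros s; assert (0 <= s * s / (c * c)) by now apply square_ratio_nonneg.
  lra. }
set (f := fun s =>
  rho * (INR n * s - a0) * s + dp * sqrt (W + s * s / (c * c))).
assert (HwW : 0 < sqrt W) by now apply sqrt_lt_R0.
assert (f0 : f 0 < 0).
{ unfold f; replace (W + 0 * 0 / (c * c)) with W by (field; lra).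
  nra. }
destruct (IVT f 0 1) as [s [Hs Es]].
- intros s; apply continuity_pt_filterlim.
  apply (ex_derive_continuous (V := R_NormedModule)).
  unfold f; auto_derive; apply Hrad.
- lra.
- exact f0.
- unfold f; set (r := sqrt (W + 1 * 1 / (c * c))) in *.
  assert (H : rho * (a0 - dp * r / rho) < rho * INR n)
    by (apply Rmult_lt_compat_l; lra).
  replace (rho * (a0 - dp * r / rho)) with (rho * a0 - dp * r) in H
    by (field; lra).
  lra.
- exists s; split; [|exact Es].
  destruct (proj1 Hs) as [P|P]; [exact P|].
  rewrite <- P in Es; lra.
Qed.

(** * Ill-posedness *)

Lemma front_wave_not_trivial (n : nat) (s : C) (w2 w3 : R) (U : unknowns field) :
  ~ is_trivial U (boundary_wave n s w2 w3 1).
Proof.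
intros [_ H]; specialize (H 1 0 0 Rlt_0_1); revert H.
unfold boundary_wave; rewrite Cmult_1_l; apply Cexp_neq_0.
Qed.

Lemma zero_amplitudes_trivial (n : nat) (s lam : C) (w2 w3 : R)
    (U : unknowns C) (phi : C) :
  all_components (fun A : C => A = 0%C) U -> phi = 0%C ->
  is_trivial (exp_unknowns n s lam w2 w3 U) (boundary_wave n s w2 w3 phi).
Proof.
intros (Hp & Hv & HF) ->.
assert (Z : forall t x1 x2 x3, interior_wave n s lam w2 w3 0 t x1 x2 x3 = 0%C)
  by (intros; apply Cmult_0_l).
split.
- intros t x1 x2 x3 _ _; unfold exp_unknowns; repeat split; simpl; intros.
  + now rewrite Hp.
  + now rewrite Hv.
  + now rewrite HF.
- intros; apply Cmult_0_l.
Qed.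

(** Along waves with [n Re s] tending to infinity, [n Re s > a0] eventually, so
    [amplitude_dispersion] applies to them. *)
Lemma bounded_growth_not_ill_posed (rho c : R) (F2 F3 : idx -> R)
    (a0 dp w2 w3 B : R) (Ubar : nat -> unknowns C) (phibar s lam : nat -> C) :
  0 < rho -> 0 < c ->
  (forall n s lam, (0 < n)%nat -> 0 < Re s -> Re lam < 0 ->
    dispersion rho c a0 dp (stiffness F2 F3 w2 w3) (w2 * w2 + w3 * w3) n s lam ->
    INR n * Re s <= B) ->
  eventually (fun n =>
    0 < Re (s n) /\ Re (lam n) < 0 /\
    let U := exp_unknowns n (s n) (lam n) w2 w3 (Ubar n) in
    let phi := boundary_wave n (s n) w2 w3 (phibar n) in
    is_solution rho c F2 F3 a0 dp U phi /\ ~ is_trivial U phi) ->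
  ~ is_lim_seq (fun n => INR n * Re (s n)) p_infty.
Proof.
intros Hrho Hc Hbound [N1 Hsol] Hlim.
apply is_lim_seq_spec in Hlim.
destruct (Hlim (Rmax a0 B)) as [N2 Hlarge].
set (n := S (Nat.max N1 N2)).
destruct (Hsol n) as (Hs & Hlam & Hwave & Hnon); [lia|].
assert (H := Hlarge n ltac:(lia)).
assert (Ha := Rmax_l a0 B); assert (HB := Rmax_r a0 B).
apply is_solution_waves in Hwave; [|lia].
assert (INR n * Re (s n) <= B); [|lra].
apply Hbound with (lam n); [lia | assumption | assumption |].
apply (amplitude_dispersion rho c F2 F3 a0 dp w2 w3 n (s n) (lam n)
  (Ubar n) (phibar n)); try assumption; [lra|].
intros [H1 H2]; apply Hnon; now apply zero_amplitudes_trivial.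
Qed.

Theorem theorem4p3 :
  forall (rho c : R) (F2 F3 : idx -> R) (a0 dp : R),
    0 < rho -> 0 < c ->
    (ill_posed rho c F2 F3 a0 dp <-> collinear F2 F3 /\ dp < 0).
Proof.
intros rho c F2 F3 a0 dp Hrho Hc; split.
- intros (w2 & w3 & Ubar & phibar & s & lam & Hsol & Hlim).
  assert (unbounded : forall B, ~ forall n s lam,
    (0 < n)%nat -> 0 < Re s -> Re lam < 0 ->
    dispersion rho c a0 dp (stiffness F2 F3 w2 w3) (w2 * w2 + w3 * w3) n s lam ->
    INR n * Re s <= B).
  { intros B HB.
    exact (bounded_growth_not_ill_posed _ _ _ _ _ _ _ _ B _ _ _ _
      Hrho Hc HB Hsol Hlim). }
  assert (HM0 := stiffness_nonneg F2 F3 w2 w3).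
  assert (HM : stiffness F2 F3 w2 w3 = 0).
  { destruct HM0 as [HM|HM]; [exfalso | auto].
    destruct (growth_bounded_stiff rho c a0 dp _ (w2 * w2 + w3 * w3)
      Hrho Hc HM) as [B HB]; [nra|].
    apply (unbounded B); eauto. }
  assert (HW : 0 < w2 * w2 + w3 * w3).
  { destruct (Rlt_dec 0 (w2 * w2 + w3 * w3)) as [H|H]; [exact H | exfalso].
    apply (unbounded (a0 - dp / (rho * c))); intros n s' lam' Hn Hs Hlam D.
    rewrite HM in D; replace (w2 * w2 + w3 * w3) with 0 in D by nra.
    right; now apply growth_tangentially_uniform with lam'. }
  split.
  + apply collinear_stiffness; eauto.
  + apply Rnot_le_lt; intros Hdp.
    apply (unbounded (Rabs a0)); intros n s' lam' Hn Hs Hlam D.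
    rewrite HM in D; exact (growth_bounded_stable_sign rho c a0 dp _ n s' lam'
      Hrho Hc Hdp Hs Hlam D).
- intros [Hcol Hdp].
  apply collinear_stiffness in Hcol as (w2 & w3 & HW & HM).
  set (W := w2 * w2 + w3 * w3) in *.
  set (T := a0 - dp * sqrt (W + 1 * 1 / (c * c)) / rho).
  destruct (INR_unbounded T) as [N HN].
  set (speed := fun s => sqrt (W + s * s / (c * c))).
  assert (mode : forall n, {m : R * unknowns C | T < INR n ->
    0 < fst m /\
    rho * (INR n * fst m - a0) * fst m + dp * speed (fst m) = 0 /\
    amplitude_equations rho c F2 F3 a0 dp w2 w3 n (fst m) (- speed (fst m))%R
      (snd m) 1}).
  { intros n; destruct (Rlt_dec T (INR n)) as [Hn|Hn].
    - destruct (real_root_exists rho c a0 dp W n Hrho Hc Hdp HW Hn)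
        as (s & Hs & Es).
      destruct (dispersion_amplitude rho c F2 F3 a0 dp w2 w3 n s (- speed s)%R)
        as [U HU]; try assumption.
      + rewrite HM; now apply dispersion_real_root.
      + exists (s, U); auto.
    (* Small [n] are irrelevant to ill-posedness: any value will do. *)
    - exists (0, Unknowns (A := C) 0%C (fun _ => 0%C) (fun _ _ => 0%C)).
      contradiction. }
  set (s := fun n => fst (proj1_sig (mode n))).
  exists w2, w3, (fun n => snd (proj1_sig (mode n))), (fun _ => 1%C),
    (fun n => RtoC (s n)), (fun n => RtoC (- speed (s n))).
  assert (Hmode := fun n => proj2_sig (mode n)); cbv beta in Hmode.
  assert (HT : forall n, (N <= n)%nat -> T < INR n).
  { intros n Hn; apply le_INR in Hn; lra. }
  split.
  + exists (S N); intros n Hn.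
    destruct (Hmode n) as (Hs & _ & HU); [apply HT; lia|].
    split; [exact Hs|]; split; [|split].
    * assert (Hpos : 0 <= s n * s n / (c * c))
        by now apply square_ratio_nonneg.
      assert (0 < speed (s n)) by (apply sqrt_lt_R0; lra).
      unfold Re; simpl; lra.
    * apply is_solution_waves; [lia | exact HU].
    * apply front_wave_not_trivial.
  + apply is_lim_seq_spec; intros B.
    destruct (real_root_growth rho c a0 dp W (Rabs B)) as [N' HN'];
      try assumption; [apply Rabs_pos|].
    exists (Nat.max N N'); intros n Hn.
    destruct (Hmode n) as (Hs & Es & _); [apply HT; lia|].
    apply Rle_lt_trans with (Rabs B); [apply Rle_abs|].
    apply HN'; [lia | apply Rlt_le, Hs | exact Es].
Qed.
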